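(* Let $D(n)$ be the largest number such that in every arrangement of $n$ lines in the plane in which no six lines are tangent to a common conic, there are $D(n)$ lines of the arrangement such that the triangles formed by triples of these lines have pairwise distinct areas. Then $n^{1/5}<D(n)$.
   Context: A triangle formed by three lines is the triangle bounded by them (three pairwise non-parallel lines; if concurrent the triangle is degenerate of area $0$). The general position hypothesis is that no six lines of the arrangement are tangent to a common (possibly degenerate) conic; in the paper's convention this in particular excludes six lines through a common point and six pairwise parallel lines.
   Formalization: The inequality is stated for n ≥ 2, since for n = 0 and n = 1 one has D(n) = n and the strict inequality n^{1/5} < D(n) fails. *)

(* Defs.v *)
From mathcomp Require Import all_boot all_order all_algebra.
From mathcomp Require Import all_classical all_reals all_analysis.

Set Implicit Arguments.
Unset Strict Implicit.
Unset Printing Implicit Defensive.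

Import Order.TTheory GRing.Theory Num.Theory.

Local Open Scope classical_set_scope.
Local Open Scope ring_scope.

(* Homogeneous coordinates: the affine point (x, y) is (x : y : 1); the row
   vector u = (a, b, c) is the line a x + b y + c z = 0. *)
Definition homog (R : realType) (p : R * R) : 'rV[R]_3 :=
  \row_(i < 3) [:: p.1; p.2; 1]`_i.

Definition incident (R : realType) (P u : 'rV[R]_3) : Prop := P *m u^T = 0.

Definition line_of (R : realType) (u : 'rV[R]_3) : set (R * R) :=
  [set p | incident (homog p) u].

(* Neither zero nor the line at infinity. *)
Definition affine_coords (R : realType) (u : 'rV[R]_3) : Prop :=
  u 0 0 != 0 \/ u 0 1 != 0.

Definition is_line (R : realType) (l : set (R * R)) : Prop :=
  exists2 u : 'rV[R]_3, affine_coords u & l = line_of u.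

(* The projective conic X Q X^T = 0.  Rank 3 is a nondegenerate conic, rank 2 a
   pair of lines (real or complex conjugate).  Rank 1, a double line, is left
   out: every line of the plane meets it with multiplicity two. *)
Definition is_conic (R : realType) (Q : 'M[R]_3) : Prop :=
  Q^T = Q /\ (2 <= \rank Q)%N.

(* [P] is the point of contact: it lies on l, and l lies in its polar.  [P] may
   be at infinity, so the asymptotes of a hyperbola are tangent to it.  For a
   rank 2 conic the tangents are the lines through the common point of its two
   components: a pencil of concurrent lines, or of parallel lines when this
   point is at infinity. *)
Definition tangent (R : realType) (Q : 'M[R]_3) (l : set (R * R)) : Prop :=
  exists u P : 'rV[R]_3,
    [/\ affine_coords u, l = line_of u, P != 0, incident P u &
        forall X : 'rV[R]_3, incident X u -> X *m Q *m P^T = 0].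

Definition line_arrangement (R : realType) (n : nat)
    (L : 'I_n -> set (R * R)) : Prop :=
  injective L /\ forall i, is_line (L i).

Definition no_six_cotangent (R : realType) (n : nat)
    (L : 'I_n -> set (R * R)) : Prop :=
  forall S : {set 'I_n}, #|S| = 6%N ->
    ~ exists2 Q : 'M[R]_3, is_conic Q & forall i, i \in S -> tangent Q (L i).

Definition area (R : realType) (p q r : R * R) : R :=
  `|(q.1 - p.1) * (r.2 - p.2) - (r.1 - p.1) * (q.2 - p.2)| / 2.

(* The three lines form a triangle, of area [a].  Two lines meet in exactly one
   point iff they are not parallel, so the singleton conditions make the lines
   pairwise non-parallel, hence distinct; concurrent lines are allowed and give
   p = q = r and a = 0. *)
Definition triangle_area (R : realType) (l1 l2 l3 : set (R * R)) (a : R) : Prop :=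
  exists p q r : R * R,
    [/\ l2 `&` l3 = [set p], l1 `&` l3 = [set q], l1 `&` l2 = [set r] &
        a = area p q r].

Definition distinct_areas (R : realType) (n : nat) (L : 'I_n -> set (R * R))
    (S : {set 'I_n}) : Prop :=
  forall (i j k i' j' k' : 'I_n) (a a' : R),
    i \in S -> j \in S -> k \in S -> i' \in S -> j' \in S -> k' \in S ->
    triangle_area (L i) (L j) (L k) a ->
    triangle_area (L i') (L j') (L k') a' ->
    [set i; j; k]%SET != [set i'; j'; k']%SET :> {set 'I_n} -> a != a'.

Definition guaranteed (R : realType) (n d : nat) : Prop :=
  forall L : 'I_n -> set (R * R),
    line_arrangement L -> no_six_cotangent L ->
    exists S : {set 'I_n}, #|S| = d /\ distinct_areas L S.

Definition is_largest (A : set nat) (d : nat) : Prop :=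
  A d /\ forall d', A d' -> (d' <= d)%N.

(* The largest guaranteed number; the default value 0 would only be taken if
   there were none. *)
Definition D (R : realType) (n : nat) : nat :=
  xget 0%N [set d | is_largest [set d' | guaranteed R n d'] d].

(* Main.v *)
Require Import Defs.
From mathcomp Require Import all_boot all_order all_algebra.
From mathcomp Require Import all_classical all_reals all_analysis.
(* Imported last, so that [set0], [subsetP], ... are those of finite sets. *)
From mathcomp Require Import fintype finset.
From mathcomp Require Import zify ring lra.

(** Write a line as [u = (u0, u1, u2)] and let [[u, v]] be [u0 v1 - u1 v0].  Lines
    [a], [b], [l] bound a triangle of area
    [det(a, b, l)^2 / (2 |[a, b] [b, l] [a, l]|)].  For fixed [a], [b], a fixed area
    and a fixed sign of [[a, l] [b, l]], the line [l] is therefore tangent to one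
    conic having [a] and [b] as asymptotes (the pencil through the common point of
    [a] and [b] when the area is 0).  As [a] and [b] are tangent to it too, there are
    at most three such [l].

    Normalise every line so that [(u0, u1)] is lexicographically positive.  Then
    [[a, l] [b, l] > 0] for two of the three ways of singling out a line [l] of a
    triple.  Hence at most [3/2 binom(n-3, 2)] triples disjoint from a triple [T]
    have the area of [T], while the triples meeting [T] are of lower order, and a
    random [m]-subset contains at most about [m^6 / (16 n)] pairs of triples of
    equal area.  Removing one line for each pair leaves more than [n^(1/5)] lines
    when [m] is about [6/5 n^(1/5)].

    That the maximum defining [D] exists needs some arrangement in general
    position: the lines [(1, t, t^3)] with [t = 1, ..., n].  On them a dual conic
    is a polynomial in [t] of degree at most 6 without [t^5], and such a
    polynomial cannot have six distinct positive roots. *)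

Set Implicit Arguments.
Unset Strict Implicit.
Unset Printing Implicit Defensive.

Import Order.TTheory GRing.Theory Num.Theory.
Local Open Scope ring_scope.

Section Counting.
Local Open Scope nat_scope.

Lemma mul_bin_ffact (n m j : nat) :
  m <= n -> 'C(n - j, n - m) * n ^_ j = 'C(n, m) * m ^_ j.
Proof.
elim: j n m => [n m mn|j IHj [|n] [|m] // mn]; first by rewrite subn0 !ffactn0 bin_sub.
  by rewrite subSS subn0 bin_small ?mul0n ?muln0 // ltnS leq_subr.
by rewrite !subSS !ffactSS mulnCA IHj // !mulnA mul_bin_diag [m.+1 * _]mulnC.
Qed.

Lemma exists_le_average (I : finType) (A : {set I}) (F : I -> nat) :
  A != set0 -> exists2 i, i \in A & #|A| * F i <= \sum_(j in A) F j.
Proof.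
move=> /set0Pn[i0 Ai0]; have [i Ai min_i] := arg_minnP F Ai0.
by exists i => //; rewrite -sum_nat_const; apply: leq_sum => j Aj; exact: min_i.
Qed.

Lemma double_counting (X Y : finType) (A : {set X}) (B : {set Y})
    (r : X -> Y -> bool) (c d k : nat) :
  {in A, forall x, d <= #|[set y in B | r x y]|} ->
  {in B, forall y, c * #|[set x in A | r x y]| <= k} ->
  c * d * #|A| <= k * #|B|.
Proof.
move=> le_d le_k; rewrite -mulnA (mulnC d) (mulnC k) -!sum_nat_const.
apply: (@leq_trans (c * \sum_(x in A) \sum_(y in B | r x y) 1)).
  rewrite leq_mul2l leq_sum ?orbT // => x Ax.
  by rewrite sum1dep_card; exact: le_d.
rewrite (exchange_big_dep (mem B)) => [|x y _ /andP[]//] /=.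
rewrite big_distrr /=; apply: leq_sum => y By.
apply: leq_trans (le_k y By); rewrite leq_mul2l -sum1dep_card.
by apply/orP; right; apply/eq_leq/eq_bigl => x; rewrite By.
Qed.

Lemma sum_fibers (I : finType) (A : {set I}) (h : I -> nat) (k : nat) (F : nat -> nat) :
  {in A, forall i, h i < k} ->
  \sum_(i in A) F (h i) = \sum_(j < k) #|[set i in A | h i == j]| * F j.
Proof.
move=> h_lt; case: k h_lt => [|k] h_lt.
  by rewrite big_ord0 big1 // => i /h_lt.
rewrite (partition_big (fun i => inord (h i) : 'I_k.+1) xpredT) //=; apply: eq_bigr => j _.
rewrite -sum_nat_const; apply: eq_big => [i|i /andP[Ai /eqP <-]].
  rewrite inE; case: (boolP (i \in A)) => //= Ai.
  by rewrite -(inj_eq val_inj) /= inordK // h_lt.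
by rewrite inordK // h_lt.
Qed.

Lemma ffact_sum_le (m : nat) :
  m ^_ 6 + 12 * m ^_ 5 + 24 * m ^_ 4 <= m ^ 5 * (m - 3).
Proof.
have [m4|] := ltnP m 4; first by rewrite !ffact_small // ltnW // ltnW.
move=> /subnK <-; move: (m - 4) => k.
have ffact2 : k ^_ 2 + 12 * k + 24 = (k + 3) * (k + 8).
  by case: k => // k; rewrite ffactSS ffactn1; lia.
have -> : (k + 4) ^_ 6 + 12 * (k + 4) ^_ 5 + 24 * (k + 4) ^_ 4 =
    (k + 4) * (k + 1) * ((k + 3) * (k + 2) * (k ^_ 2 + 12 * k + 24)).
  by rewrite addn4 !ffactSS ffactn1 ffactn0; lia.
rewrite (_ : (k + 4) ^ 5 * (k + 4 - 3) = (k + 4) * (k + 1) * (k + 4) ^ 4); last first.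
  by rewrite (_ : k + 4 - 3 = k + 1) ?[in LHS]expnS; lia.
by rewrite ffact2 leq_mul2l !expnS expn0; apply/orP; right; lia.
Qed.

(* With [m = 6 N / 5] the expected number [m ^ 6 / (16 N ^ 5)] of deleted points
   is below [m - N], because [6/5 - (6/5) ^ 6 / 16 > 1]. *)
Lemma exists_sample_size (N : nat) : 3 <= N ->
  exists m, [/\ N < m, m <= N ^ 5 & m ^ 5 * (m - 3) < 16 * (N ^ 5 - 5) * (m - N)].
Proof.
move=> N3; have [t [r [-> r5]]] : exists t r, N = 5 * t + 3 + r /\ r < 5.
  by exists ((N - 3) %/ 5), ((N - 3) %% 5); lia.
exists (6 * t + 4 + r + (2 < r)); rewrite !expnS expn0.
(* [lia] needs the signs of these monomials. *)
have [? ? ? [? ?]] : [/\ 0 <= t * t, 0 <= t * t * t, 0 <= t * t * t * t &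
  0 <= t * t * t * t * t /\ 0 <= t * t * t * t * t * t] by [].
by move: r5; case: r => [|[|[|[|[|]]]]] // _ /=; split; lia.
Qed.

End Counting.

Section Hypergraphs.
Local Open Scope nat_scope.
Variable V : finType.
Implicit Types (S T U e : {set V}) (H : {set {set V}}).

Lemma exists_subset_card S k :
  k <= #|S| -> exists2 S' : {set V}, S' \subset S & #|S'| = k.
Proof.
move=> /card_geqP[s [us <- sS]]; exists [set x in s].
  by apply/subsetP => x; rewrite inE => /sS.
by rewrite cardsE; apply/card_uniqP.
Qed.

Lemma card_draws_superset U m :
  m <= #|V| ->
  #|[set S : {set V} | (#|S| == m) && (U \subset S)]| = 'C(#|V| - #|U|, #|V| - m).
Proof.
move=> mV; rewrite -[#|V| - #|U|](congr1 (subn^~ #|U|) (cardsC U)) addKn -cards_draws.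
rewrite -(card_imset _ (@setC_inj V)); congr #|pred_of_set _|.
apply/setP => S; rewrite inE.
apply/imsetP/andP => [[S' + ->]|[SU /eqP cS]].
  by rewrite inE setCS => /andP[/eqP <- ->]; rewrite [#|~: S'|]cardsCs setCK.
exists (~: S); last by rewrite setCK.
by rewrite inE cardsCs setCK cS subKn // eqxx /= -setCS setCK.
Qed.

Lemma exists_independent_deletion S H :
  set0 \notin H -> exists2 S', H ::&: S' = set0 & #|S| <= #|S'| + #|H ::&: S|.
Proof.
move=> H0; pose hits := [set [pick x in e] | e : {set V} in H ::&: S].
exists [set x in S | Some x \notin hits].
  apply/setP => e; rewrite inE [RHS]in_set0; apply/negP => /andP[He /subsetP eS].
  have eHS : e \in H ::&: S.
    by rewrite inE He; apply/subsetP => x /eS; rewrite inE => /andP[].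
  have := imset_f (fun e : {set V} => [pick x in e]) eHS; rewrite -/hits.
  case: pickP => [x /eS|e0]; first by rewrite inE => /andP[_ /negP].
  by move: H0; rewrite (_ : set0 = e) ?He //; apply/setP => x; rewrite in_set0 e0.
rewrite -(cardsID [set x | Some x \notin hits] S) leq_add //.
  by apply/subset_leq_card/subsetP => x; rewrite !inE.
apply: leq_trans (leq_imset_card (fun e : {set V} => [pick x in e]) _).
rewrite -(card_imset _ Some_inj); apply/subset_leq_card/subsetP => y.
by case/imsetP => x; rewrite !inE negbK => /andP[hx _] ->.
Qed.

(* The alteration method: delete a vertex of each edge of an average [m]-set. *)
Lemma exists_independent_alteration H m :
  set0 \notin H -> m <= #|V| ->
  exists2 S, H ::&: S = set0 &
    'C(#|V|, m) * (m - #|S|) <= \sum_(e in H) 'C(#|V| - #|e|, #|V| - m).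
Proof.
move=> H0 mV; pose draws := [set S : {set V} | #|S| == m].
have draws_card : #|draws| = 'C(#|V|, m) by rewrite card_draws.
have [|S Sm le_avg] := exists_le_average (fun S => #|H ::&: S|) (_ : draws != set0).
  by rewrite -card_gt0 draws_card bin_gt0.
have [S' S'_indep le_S] := exists_independent_deletion S H0.
exists S' => //; rewrite inE in Sm.
apply: (@leq_trans (#|draws| * #|H ::&: S|)).
  by rewrite draws_card leq_mul2l leq_subLR -(eqP Sm) le_S orbT.
apply: leq_trans le_avg _.
rewrite (eq_bigr (fun S => \sum_(e in H | e \subset S) 1)) => [|T _]; last first.
  by rewrite sum1dep_card.
rewrite (exchange_big_dep (mem H)) => [|T e _ /andP[]//] /=.
apply/eq_leq/eq_bigr => e He; rewrite -card_draws_superset // -sum1dep_card.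
by apply: eq_bigl => T; rewrite inE He.
Qed.

Lemma cards3 (a b c : V) : (#|[set a; b; c]| == 3) = [&& a != b, a != c & b != c].
Proof.
rewrite -setUA cardsU1 cards2 !inE.
by case: (a == b); case: (a == c); case: (b == c).
Qed.

Lemma set3_sym_ind (P : V -> V -> V -> Prop) (i j k a b c : V) :
  (forall x y z, P x y z -> P y x z) -> (forall x y z, P x y z -> P x z y) ->
  #|[set a; b; c]| = 3 -> [set i; j; k] = [set a; b; c] -> P i j k -> P a b c.
Proof.
move=> P12 P23 /eqP; rewrite cards3 => /and3P[ab ac bc] /esym E Pijk.
have : [&& a \in [set i; j; k], b \in [set i; j; k] & c \in [set i; j; k]].
  by rewrite -E !inE !eqxx !orbT.
move: ab ac bc; rewrite !inE -!orbA => ab ac bc.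
case/and3P=> /or3P[]/eqP ea /or3P[]/eqP eb /or3P[]/eqP ec; move: ab ac bc;
  rewrite ea eb ec ?eqxx // => _ _ _; auto.
Qed.

Lemma card3_through_pair T (a b : V) :
  #|T| = 3 -> a != b -> [set a; b] \subset T -> exists l, T = [set a; b; l].
Proof.
move=> cT ab abT; have /eqP/cards1P[l El] : #|T :\: [set a; b]| = 1.
  by rewrite cardsD (setIidPr abT) cT cards2 ab.
by exists l; rewrite -El -{1}(setIidPr abT) setID.
Qed.

Definition off_diagonal T : {set V * V} := [set p in setX T T | p.1 != p.2].

Lemma card_off_diagonal T : #|off_diagonal T| = #|T| * #|T|.-1.
Proof.
rewrite -sum1_card (eq_bigl (fun p => (p.1 \in T) && ((p.2 \in T) && (p.1 != p.2)))).
  rewrite -(pair_big_dep (mem T) (fun a b => (b \in T) && (a != b)) (fun _ _ => 1)) /=.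
  rewrite -sum_nat_const; apply: eq_bigr => a Ta.
  rewrite sum1dep_card (cardsD1 a T) Ta; congr #|pred_of_set _|.
  by apply/setP => b; rewrite !inE andbC eq_sym.
by move=> p; rewrite !inE andbA.
Qed.

Definition codegree H (a b : V) := #|[set e in H | [set a; b] \subset e]|.

Lemma card_meeting_across H T (r k i : nat) :
  {in H, forall e, #|e| = r} -> (forall a b, a != b -> codegree H a b <= k) ->
  i * (r - i) * #|[set e in H | #|T :&: e| == i]| <= k * (#|T| * #|~: T|).
Proof.
move=> H_unif H_codeg; rewrite -cardsX -[_ * (_ - _)]mul1n.
apply: (double_counting (r := fun e p => [set p.1; p.2] \subset e)) => [e|[a b]].
  rewrite inE => /andP[He /eqP cTe].
  have -> : i * (r - i) = #|setX (T :&: e) (e :\: T)|.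
    by rewrite cardsX cardsD (setIC e) cTe (H_unif e He).
  apply/subset_leq_card/subsetP => p; rewrite !inE subUset !sub1set.
  by move=> /andP[/andP[-> ->] /andP[-> ->]].
rewrite !inE mul1n => /andP[aT bT].
apply: leq_trans (H_codeg a b _); last by apply: contraNneq bT => <-.
by apply/subset_leq_card/subsetP => e; rewrite !inE => /andP[/andP[-> _] ->].
Qed.

Lemma card_meeting_within H T (k i : nat) :
  (forall a b, a != b -> codegree H a b <= k) ->
  i * i.-1 * #|[set e in H | #|T :&: e| == i]| <= k * (#|T| * #|T|.-1).
Proof.
move=> H_codeg; rewrite -card_off_diagonal -[i * _]mul1n.
apply: (double_counting (r := fun e p => [set p.1; p.2] \subset e)) => [e|[a b]].
  rewrite inE => /andP[_ /eqP <-]; rewrite -card_off_diagonal.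
  apply/subset_leq_card/subsetP => p; rewrite !inE subUset !sub1set.
  by move=> /andP[/andP[/andP[-> ->] /andP[-> ->]] ->].
rewrite !inE mul1n => /andP[_ ab]; apply: leq_trans (H_codeg a b ab).
by apply/subset_leq_card/subsetP => e; rewrite !inE => /andP[/andP[-> _] ->].
Qed.

Section ColouredTriples.

Variables (C : eqType) (G : {set {set V}}) (colour : {set V} -> C).
Variable outer : V -> V -> V -> bool.

Definition colour_class c := [set T in G | colour T == c].

Definition conflicts : {set {set V}} :=
  [set T :|: T' | T in G, T' in G & (T != T') && (colour T == colour T')].

Definition rainbow S : Prop := {in G ::&: S &, injective colour}.

Hypothesis G_triples : {in G, forall T, #|T| = 3}.
Hypothesis outerC : forall a b l, outer a b l = outer b a l.
Hypothesis two_outer : {in G, forall T,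
  exists a b l, [/\ T = [set a; b; l], outer a b l & outer b l a]}.
Hypothesis outer_codegree : forall c a b (s : bool), a != b ->
  #|[set l | ([set a; b; l] \in colour_class c) && (outer a b l == s)]| <= 3.

Lemma rainbow_no_conflict S : conflicts ::&: S = set0 -> rainbow S.
Proof.
move=> noC T T'; rewrite !inE => /andP[GT TS] /andP[GT' T'S] cTT'.
apply/eqP/negPn/negP => TT'; have := in_set0 (T :|: T').
by rewrite -noC !inE subUset TS T'S andbT imset2_f // inE GT' TT' cTT' /=.
Qed.

Lemma card_triple_setI_lt3 : {in G &, forall T T', T != T' -> #|T :&: T'| < 3}.
Proof.
move=> T T' GT GT'; apply: contraNltn => I3; apply/eqP.
have sub (A B : {set V}) : A \in G -> #|A :&: B| >= 3 -> A \subset B.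
  move=> GA; rewrite -{1}(G_triples GA) => cAB.
  by apply/setIidPl/eqP; rewrite eqEcard subsetIl.
by apply/eqP; rewrite eqEsubset !sub // setIC.
Qed.

Lemma codegree_colour_class c a b : a != b -> codegree (colour_class c) a b <= 6.
Proof.
move=> ab.
pose link s := [set l | ([set a; b; l] \in colour_class c) && (outer a b l == s)].
apply: (@leq_trans #|link true :|: link false|); last first.
  by apply: leq_trans (leq_card_setU _ _) _; rewrite -[6]/(3 + 3) leq_add ?outer_codegree.
apply: leq_trans (leq_imset_card (fun l => [set a; b; l]) _).
apply/subset_leq_card/subsetP => T; rewrite inE => /andP[cT abT].
have [l eT] : exists l, T = [set a; b; l].
  by apply: card3_through_pair => //; apply: G_triples; move: cT; rewrite inE => /andP[].
apply/imsetP; exists l => //.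
by rewrite in_setU ![_ \in link _]in_set -eT cT; case: (outer a b l).
Qed.

Lemma card_disjoint_class c T :
  4 * #|[set T' in colour_class c | #|T :&: T'| == 0]| <= 3 * (#|~: T| * #|~: T|.-1).
Proof.
rewrite -card_off_diagonal -[4]mul1n.
pose sees T' (p : V * V) := [exists l, (T' == [set p.1; p.2; l]) && outer p.1 p.2 l].
apply: (double_counting (r := sees)) => [T'|[a b]]; last first.
  rewrite !inE mul1n => /andP[_ ab]; apply: leq_trans (outer_codegree c true ab).
  apply: leq_trans (leq_imset_card (fun l => [set a; b; l]) _).
  apply/subset_leq_card/subsetP => T'; rewrite in_set => /andP[T'_class /existsP[l]].
  move=> /andP[/eqP eT' abl_outer]; move: T'_class; rewrite in_set eT' => /andP[abl_class _].
  by apply: imset_f; rewrite in_set eqb_id abl_outer andbT.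
rewrite inE cards_eq0 setI_eq0 disjoint_sym disjoints_subset => /andP[+ /subsetP T'_disj].
rewrite inE => /andP[GT' _].
have sees_pair x y z : T' = [set x; y; z] -> outer x y z ->
    (x, y) \in [set p in off_diagonal (~: T) | sees T' p].
  move=> eT' xyz_outer; have [xT' yT'] : x \in T' /\ y \in T' by rewrite eT' !inE !eqxx ?orbT.
  move: (G_triples GT'); rewrite eT' => /eqP; rewrite cards3 => /andP[xy _].
  move: (T'_disj x xT') (T'_disj y yT'); rewrite !inE => -> ->; rewrite xy /=.
  by apply/existsP; exists z; rewrite eqxx.
have [a [b [l [eT' ab_outer bl_outer]]]] := two_outer GT'.
move: (G_triples GT'); rewrite {1}eT' => /eqP; rewrite cards3 => /and3P[ab al bl].
apply/card_geqP; exists [:: (a, b); (b, a); (b, l); (l, b)]; split=> //.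
  by rewrite /= !inE !xpair_eqE (eq_sym b a) (negbTE ab) (negbTE al) (negbTE bl) ?andbF.
move=> p; rewrite 3!in_cons mem_seq1 => /or4P[]/eqP->.
- exact: sees_pair eT' ab_outer.
- by apply: (sees_pair _ _ l); rewrite 1?outerC // eT' (setUC [set b]).
- by apply: (sees_pair _ _ a); rewrite // eT' -setUA setUC.
- by apply: (sees_pair _ _ a); rewrite 1?outerC // eT' (setUC [set l]) -setUA setUC.
Qed.

Let n := #|V|.

(* Two triples with [i] common points have a union of [6 - i] points. *)
Definition conflicts_of_overlap (i : nat) := [set e in conflicts | 6 - #|e| == i].

Lemma conflict_card e : e \in conflicts -> 3 < #|e| <= 6.
Proof.
case/imset2P => T T' GT; rewrite inE => /and3P[GT' TT' _] ->.
have := card_triple_setI_lt3 GT GT' TT'; rewrite cardsU (G_triples GT) (G_triples GT'); lia.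
Qed.

Lemma card_conflicts_of_overlap (d i k : nat) :
  {in G, forall T, d * #|[set T' in colour_class (colour T) | #|T :&: T'| == i]| <= k} ->
  d * 2 * #|conflicts_of_overlap i| <= k * 'C(n, 3).
Proof.
move=> le_k; pose r e T :=
  [exists T' in G, [&& T != T', colour T == colour T' & e == T :|: T']].
apply: (@leq_trans (k * #|G|)); last first.
  rewrite leq_mul2l -card_draws subset_leq_card ?orbT //.
  by apply/subsetP => T GT; rewrite inE G_triples.
apply: (double_counting (r := r)) => [e|T GT].
  rewrite inE => /andP[/imset2P[T T' GT]]; rewrite inE => /and3P[GT' TT' cTT'] -> _.
  apply/card_geqP; exists [:: T; T']; split=> [|//|A]; first by rewrite /= inE TT'.
  rewrite !inE => /orP[]/eqP ->; apply/andP; split=> //; apply/existsP.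
    by exists T'; rewrite GT' TT' cTT' eqxx.
  by exists T; rewrite GT eq_sym TT' eq_sym cTT' setUC eqxx.
apply: leq_trans (le_k T GT); rewrite leq_mul2l; apply/orP; right.
apply: leq_trans (leq_imset_card (fun T' => T :|: T') _).
apply/subset_leq_card/subsetP => e; rewrite !inE => /andP[/andP[_ ce]].
case/existsP => T' /and4P[GT' TT' cTT' /eqP eU].
rewrite eU imset_f // !inE GT' eq_sym cTT'; have := card_triple_setI_lt3 GT GT' TT'.
move: ce; rewrite eU cardsU (G_triples GT) (G_triples GT') => /eqP; lia.
Qed.

Lemma conflict_counts :
  [/\ 16 * (n - 5) * #|conflicts_of_overlap 0| <= n ^_ 6,
      16 * (n - 5) * #|conflicts_of_overlap 1| <= 12 * n ^_ 5 &
      16 * (n - 5) * #|conflicts_of_overlap 2| <= 24 * n ^_ 4].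
Proof.
have C3 : 6 * 'C(n, 3) = n ^_ 3 by rewrite -bin_ffact mulnC.
have class_triples c : {in colour_class c, forall T, #|T| = 3}.
  by move=> T; rewrite inE => /andP[/G_triples].
have card_setC T : T \in G -> #|~: T| = n - 3.
  by move=> GT; rewrite -(G_triples GT) /n -(cardsC T) addKn.
have disjoint : 4 * 2 * #|conflicts_of_overlap 0| <= 3 * ((n - 3) * (n - 4)) * 'C(n, 3).
  apply: card_conflicts_of_overlap => T GT; apply: leq_trans (card_disjoint_class _ _) _.
  by rewrite card_setC // -subnS.
have once : 2 * 2 * #|conflicts_of_overlap 1| <= 6 * (3 * (n - 3)) * 'C(n, 3).
  apply: card_conflicts_of_overlap => T GT.
  have := card_meeting_across T 1 (class_triples (colour T)) (@codegree_colour_class _).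
  by rewrite card_setC // G_triples.
have twice : 2 * 2 * #|conflicts_of_overlap 2| <= 6 * (3 * 2) * 'C(n, 3).
  apply: card_conflicts_of_overlap => T GT.
  by have := card_meeting_within T 2 (@codegree_colour_class (colour T)); rewrite G_triples.
rewrite (ffactnSr n 5) (ffactnSr n 4) (ffactnSr n 3) -C3.
by split; nia.
Qed.

Lemma sum_conflicts_le (m : nat) : m <= n ->
  16 * (n - 5) * (\sum_(e in conflicts) 'C(n - #|e|, n - m)) <=
    'C(n, m) * (m ^_ 6 + 12 * m ^_ 5 + 24 * m ^_ 4).
Proof.
move=> mn; rewrite (eq_bigr (fun e => 'C(n - (6 - (6 - #|e|)), n - m))); last first.
  by move=> e /conflict_card /andP[_ e6]; rewrite subKn.
rewrite (sum_fibers (k := 3) (fun i => 'C(n - (6 - i), n - m))); last first.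
  by move=> e /conflict_card; lia.
have weigh E c j : 16 * (n - 5) * E <= c * n ^_ j ->
    16 * (n - 5) * (E * 'C(n - j, n - m)) <= 'C(n, m) * (c * m ^_ j).
  move=> le_E; rewrite mulnA [leqRHS]mulnCA -mul_bin_ffact // mulnCA mulnC.
  by rewrite leq_mul2l le_E orbT.
have [le6 le5 le4] := conflict_counts; rewrite -[n ^_ 6]mul1n in le6.
have := leq_add (leq_add (weigh _ _ _ le6) (weigh _ _ _ le5)) (weigh _ _ _ le4).
by rewrite -!mulnDr mul1n !big_ord_recl big_ord0 addn0 addnA.
Qed.

Lemma rainbow_le3 S : #|S| <= 3 -> rainbow S.
Proof.
move=> S3 T T'; have eqS A : A \in G ::&: S -> A = S.
  by rewrite inE => /andP[GA AS]; apply/eqP; rewrite eqEcard AS (G_triples GA).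
by move=> /eqS-> /eqS->.
Qed.

Lemma exists_rainbow_set (N : nat) : N < n -> N ^ 5 <= n ->
  exists2 S : {set V}, #|S| = N.+1 & rainbow S.
Proof.
move=> Nn N5n; have [N2|N3] := leqP N 2.
  have [|S _ cS] := @exists_subset_card [set: V] N.+1; first by rewrite cardsT Nn.
  by exists S => //; apply: rainbow_le3; rewrite cS.
have [m [Nm mN lt_m]] := exists_sample_size N3; have mn := leq_trans mN N5n.
have [|S S_indep le_S] := @exists_independent_alteration conflicts m _ mn.
  by apply/negP => /conflict_card; rewrite cards0.
have NS : N < #|S|.
  have Cm : 0 < 'C(n, m) by rewrite bin_gt0.
  have : 16 * (n - 5) * (m - #|S|) < 16 * (n - 5) * (m - N).
    apply: (@leq_trans (16 * (N ^ 5 - 5) * (m - N))); last first.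
      by rewrite !leq_mul // leq_sub2r.
    apply: leq_ltn_trans lt_m; apply: leq_trans (ffact_sum_le m).
    rewrite -(leq_pmul2l Cm); apply: leq_trans (sum_conflicts_le mn).
    by rewrite mulnCA leq_mul2l le_S orbT.
  by rewrite ltn_mul2l => /andP[_]; lia.
have [A AS cA] := exists_subset_card NS; exists A => //.
apply: sub_in2 (rainbow_no_conflict S_indep) => T.
by rewrite !inE => /andP[-> /subset_trans->].
Qed.

End ColouredTriples.

End Hypergraphs.

Section DualForm.
Variables (R : comNzRingType) (n : nat).
Implicit Types (A : 'M[R]_n) (u : 'rV[R]_n).

Definition dual_form A u : R := (u *m \adj A *m u^T) 0 0.

Lemma dual_formP A u : reflect (u *m \adj A *m u^T = 0) (dual_form A u == 0).
Proof.
apply: (iffP eqP) => [uAu|]; last by rewrite /dual_form => ->; rewrite mxE.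
by apply/matrixP => i j; rewrite !ord1 [RHS]mxE.
Qed.

Lemma dual_formZ A a u : dual_form A (a *: u) = a ^+ 2 * dual_form A u.
Proof. by rewrite /dual_form linearZ -!scalemxAl -scalemxAr !mxE mulrA. Qed.

End DualForm.

Section Contact.
Variable F : fieldType.

Lemma submx_orthogonal (m k n : nat) (A : 'M[F]_(m, n)) (B : 'M[F]_(k, n)) :
  (forall X : 'rV_n, X *m A^T = 0 -> X *m B^T = 0) -> (B <= A)%MS.
Proof.
move=> orthAB; rewrite submxE -(inj_eq (@trmx_inj _ _ _)) trmx0 trmx_mul.
apply/eqP/row_matrixP => i; rewrite row_mul row0; apply: orthAB.
by rewrite -row_mul -trmx_mul mulmx_coker trmx0 row0.
Qed.

Lemma exists_submx_row' (m n : nat) (A : 'M[F]_(m.+1, n)) :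
  (\rank A <= m)%N -> exists i, (A <= row' i A)%MS.
Proof.
move=> rkA; have /row_freePn[i row_iA] : ~~ row_free A by rewrite /row_free neq_ltn ltnS rkA.
exists i; apply/row_subP => j; have [->//|] := eqVneq j i.
rewrite eq_sym => /unlift_some[k -> _].
rewrite (_ : row _ A = row k (row' i A)) ?row_sub //.
by apply/rowP => l; rewrite !mxE.
Qed.

Variable n : nat.
Implicit Types (A : 'M[F]_n.+1) (u P X : 'rV[F]_n.+1).

Lemma adj_neq0 A : (\adj A != 0) = (n <= \rank A)%N.
Proof.
apply/matrix0Pn/idP => [[i [j]]|rkA].
  rewrite mxE /cofactor mulf_eq0 signr_eq0 -unitfE -unitmxE.
  move=> /mxrank_unit/esym/eq_leq/leq_trans; apply.
  apply: (@leq_trans (\rank (col' i A))); first by rewrite mxrankS // rowsub_sub.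
  by rewrite -mxrank_tr -[leqRHS]mxrank_tr tr_col' mxrankS // rowsub_sub.
have [An|nA] := leqP (\rank A) n; last first.
  have : A \in unitmx by rewrite -row_full_unit /row_full eqn_leq rank_leq_col.
  rewrite unitmxE unitfE => detA; apply/matrix0Pn; apply: contraNneq detA => adjA0.
  by have := mul_adj_mx A; rewrite adjA0 mul0mx => /matrixP/(_ 0 0); rewrite !mxE => /esym/eqP.
have [i Ai] := exists_submx_row' An.
have [|j Bj] := @exists_submx_row' _ _ (row' i A)^T; first by rewrite mxrank_tr rank_leq_row.
exists j, i; rewrite mxE /cofactor mulf_neq0 ?signr_eq0 //.
rewrite -unitfE -unitmxE -row_free_unit /row_free eqn_leq rank_leq_row.
apply: leq_trans rkA _; apply: leq_trans (mxrankS Ai) _.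
rewrite -[leqRHS]mxrank_tr (_ : _^T = row' j (row' i A)^T); last first.
  by apply/matrixP => k l; rewrite !mxE.
by rewrite -[leqLHS]mxrank_tr mxrankS.
Qed.

Lemma adj_sub_kernel A P : (n <= \rank A)%N -> P != 0 -> P *m A = 0 -> (\adj A <= P)%MS.
Proof.
move=> rkA P0 PA; have P_ker : (P <= kermx A)%MS by rewrite sub_kermx PA.
have detA : \det A = 0 by apply/eqP/det0P; exists P.
have adj_ker : (\adj A <= kermx A)%MS by rewrite sub_kermx mul_adj_mx detA -scalemx1 scale0r.
apply: submx_trans adj_ker _.
by rewrite -(geq_leqif (mxrank_leqif_sup P_ker)) mxrank_ker rank_rV P0 leq_subLR addn1.
Qed.

Lemma contact_dual_form_eq0 A u P :
  A^T = A -> (n <= \rank A)%N -> P != 0 -> P *m u^T = 0 ->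
  (forall X, X *m u^T = 0 -> X *m A *m P^T = 0) -> dual_form A u = 0.
Proof.
move=> symA rkA P0 Pu PA; apply/eqP/dual_formP.
have /sub_rVP[a PAu] : (P *m A <= u)%MS.
  by apply: submx_orthogonal => X /PA; rewrite trmx_mul symA mulmxA.
have [a0|a0] := eqVneq a 0.
  have /submxP[D ->] : (\adj A <= P)%MS by rewrite adj_sub_kernel // PAu a0 scale0r.
  by rewrite -!mulmxA Pu !mulmx0.
rewrite {1}(_ : u = a^-1 *: (P *m A)); last by rewrite PAu scalerA mulVf // scale1r.
rewrite -!scalemxAl -[P *m A *m _]mulmxA mul_mx_adj mul_mx_scalar.
by rewrite -scalemxAl Pu !scaler0.
Qed.

(* The point of contact is the pole [u *m \adj A] of [u], or the vertex of [A]
   when [A] is singular and [u] passes through it. *)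
Lemma dual_form_eq0_contact A u :
  A^T = A -> (n <= \rank A)%N -> u != 0 -> dual_form A u = 0 ->
  exists P, [/\ P != 0, P *m u^T = 0 & forall X, X *m u^T = 0 -> X *m A *m P^T = 0].
Proof.
move=> symA rkA u0 /eqP/dual_formP uAu.
have sym_adj : (\adj A)^T = \adj A by rewrite trmx_adj symA.
have [uA0|uA0] := eqVneq (u *m \adj A) 0; last first.
  exists (u *m \adj A); split=> // X Xu.
  rewrite trmx_mul sym_adj -mulmxA [A *m _]mulmxA mul_mx_adj.
  by rewrite mul_scalar_mx -scalemxAr Xu scaler0.
have [i [j Aij]] : exists i j, \adj A i j != 0 by apply/matrix0Pn; rewrite adj_neq0.
exists (row i (\adj A)); split.
- by apply/rV0Pn; exists j; rewrite mxE.
- by rewrite -row_mul -[\adj A]sym_adj -trmx_mul uA0 trmx0 row0.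
have detA : \det A = 0.
  have : \det A *: u = 0 by rewrite -mul_mx_scalar -mul_adj_mx mulmxA uA0 mul0mx.
  by move=> /eqP; rewrite scaler_eq0 (negbTE u0) orbF => /eqP.
move=> X _; rewrite tr_row sym_adj colE !mulmxA -[X *m A *m _]mulmxA mul_mx_adj detA.
by rewrite -scalemx1 scale0r mulmx0 mul0mx.
Qed.

End Contact.

Lemma ord3E (i : 'I_3) : [\/ i = 0, i = 1 | i = 2].
Proof.
by case: i => [[|[|[|//]]] h]; [constructor 1|constructor 2|constructor 3]; apply/val_inj.
Qed.

Lemma ord3D :
  ((0 + 1 = 1 :> 'I_3)%R * (0 + 2 = 2 :> 'I_3)%R * (1 + 1 = 2 :> 'I_3)%R *
   (1 + 2 = 0 :> 'I_3)%R * (2 + 1 = 0 :> 'I_3)%R * (2 + 2 = 1 :> 'I_3)%R)%type.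
Proof. by do !split; apply/val_inj. Qed.

Lemma sum3E (M : nmodType) (F : 'I_3 -> M) : \sum_i F i = F 0 + F 1 + F 2.
Proof.
rewrite !big_ord_recl big_ord0 addr0 addrA.
by congr (F _ + F _ + F _); apply/val_inj.
Qed.

Section ThreeCoordinates.
Variable R : comNzRingType.
Implicit Types (a b u v w : 'rV[R]_3) (A : 'M[R]_3) (k : R).

Definition row3 (x y z : R) : 'rV[R]_3 := \row_(i < 3) [:: x; y; z]`_i.

Definition bracket u v : R := u 0 0 * v 0 1 - u 0 1 * v 0 0.

Definition det3 u v w : R :=
  u 0 2 * bracket v w + v 0 2 * bracket w u + w 0 2 * bracket u v.

Lemma row3E (x y z : R) :
  ((row3 x y z 0 0 = x) * (row3 x y z 0 1 = y) * (row3 x y z 0 2 = z))%type.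
Proof. by rewrite !mxE. Qed.

Lemma dot3E u v : (u *m v^T) 0 0 = u 0 0 * v 0 0 + u 0 1 * v 0 1 + u 0 2 * v 0 2.
Proof. by rewrite mxE sum3E !mxE. Qed.

Lemma bracketC u v : bracket v u = - bracket u v.
Proof. by rewrite /bracket; ring. Qed.

Lemma bracketxx u : bracket u u = 0.
Proof. by rewrite /bracket; ring. Qed.

(* The cyclic order of the indices absorbs the signs of the cofactors. *)
Lemma adj3E A i j :
  \adj A i j = A (j + 1) (i + 1) * A (j + 2) (i + 2) - A (j + 1) (i + 2) * A (j + 2) (i + 1).
Proof.
have [B AB] : exists B, forall i j, A i j = B (val i) (val j).
  by exists (fun i j => A (inord i) (inord j)) => k l; rewrite !inord_val.
rewrite mxE /cofactor (expand_det_row _ 0) !big_ord_recl big_ord0 /cofactor !det_mx11 !mxE !AB.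
by case: (ord3E i) => ->; case: (ord3E j) => -> /=; rewrite /bump /=; ring.
Qed.

(* The conic [2 (a X) (b X) = k z ^ 2], whose asymptotes are [a] and [b]. *)
Definition hyperbola a b k : 'M[R]_3 := a^T *m b + b^T *m a - k *: delta_mx 2 2.

Lemma hyperbolaE a b k i j :
  hyperbola a b k i j = a 0 i * b 0 j + b 0 i * a 0 j - k * ((i == 2) && (j == 2))%:R.
Proof. by rewrite !mxE !big_ord1 !mxE. Qed.

Lemma tr_hyperbola a b k : (hyperbola a b k)^T = hyperbola a b k.
Proof. by apply/matrixP => i j; rewrite mxE !hyperbolaE andbC; ring. Qed.

Lemma dual_form_hyperbola a b k u :
  dual_form (hyperbola a b k) u =
    - (det3 a b u ^+ 2 + 2 * k * (bracket a u * bracket b u)).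
Proof.
rewrite /dual_form mxE sum3E !mxE !sum3E !adj3E !ord3D !hyperbolaE /= /det3 /bracket.
ring.
Qed.

End ThreeCoordinates.

Lemma rank_hyperbola (F : fieldType) (a b : 'rV[F]_3) (k : F) :
  bracket a b != 0 -> (2 <= \rank (hyperbola a b k))%N.
Proof.
move=> ab; rewrite -adj_neq0; apply/matrix0Pn; exists 2, 2.
have -> : \adj (hyperbola a b k) 2 2 = - bracket a b ^+ 2.
  by rewrite adj3E !ord3D !hyperbolaE /bracket /=; ring.
by rewrite oppr_eq0 sqrf_eq0.
Qed.

Section Directions.
Variable R : realDomainType.
Implicit Types a b l u v w : 'rV[R]_3.

(* The direction of [l] lies outside the sector spanned by [a] and [b]. *)
Definition outside a b l : bool := 0 < bracket a l * bracket b l.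

Lemma outsideC a b l : outside a b l = outside b a l.
Proof. by rewrite /outside mulrC. Qed.

Lemma outsideE a b l : bracket a l != 0 -> bracket b l != 0 ->
  outside a b l = ((0 < bracket a l) == (0 < bracket b l)).
Proof.
rewrite /outside; case: (ltgtP 0 (bracket a l)) => // al _ bl0.
  by rewrite pmulr_rgt0 // eqTb.
by rewrite nmulr_rgt0 // eq_sym eqbF_neg -leNgt le_eqVlt (negbTE bl0).
Qed.

Definition lex_pos u : bool := (0 < u 0 0) || (u 0 0 == 0) && (0 < u 0 1).

Lemma lex_pos_acyclic u v w : lex_pos u -> lex_pos v -> lex_pos w ->
  0 < bracket u v -> 0 < bracket v w -> 0 < bracket w u -> False.
Proof.
have ge0 (y : 'rV[R]_3) : lex_pos y -> 0 <= y 0 0.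
  by case/orP => [/ltW //|/andP[/eqP -> _]].
move=> /ge0 u0 /ge0 v0 /ge0 w0 uv vw wu.
have sum0 : u 0 0 * bracket v w + v 0 0 * bracket w u + w 0 0 * bracket u v = 0.
  by rewrite /bracket; ring.
have u00 : u 0 0 = 0 by nra.
have v00 : v 0 0 = 0 by nra.
by move: uv; rewrite /bracket u00 v00; lra.
Qed.

Lemma outside_two_of_three u v w : lex_pos u -> lex_pos v -> lex_pos w ->
  bracket u v != 0 -> bracket v w != 0 -> bracket u w != 0 ->
  [|| outside u v w && outside v w u, outside v w u && outside w u v
    | outside w u v && outside u v w].
Proof.
move=> u_pos v_pos w_pos uv vw uw.
have [vu wv wu] : [/\ bracket v u != 0, bracket w v != 0 & bracket w u != 0].
  by rewrite (bracketC u v) (bracketC v w) (bracketC u w) !oppr_eq0.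
have flip_gt0 (y z : 'rV[R]_3) : bracket y z != 0 -> (0 < bracket z y) = ~~ (0 < bracket y z).
  by move=> yz; rewrite (bracketC y) oppr_gt0 -leNgt le_eqVlt (negbTE yz).
rewrite !outsideE // (flip_gt0 _ _ uv) (flip_gt0 _ _ vw) (flip_gt0 _ _ uw).
have := lex_pos_acyclic u_pos v_pos w_pos; have := lex_pos_acyclic u_pos w_pos v_pos.
rewrite (flip_gt0 _ _ uv) (flip_gt0 _ _ vw) (flip_gt0 _ _ uw).
case: (0 < bracket u v); case: (0 < bracket v w); case: (0 < bracket u w) => //=.
  by move=> _ /(_ isT isT isT).
by move=> /(_ isT isT isT).
Qed.

End Directions.

Section Lines.
Variable R : realType.
Implicit Types (a b l u v w : 'rV[R]_3) (p q r : R * R) (Q : 'M[R]_3) (x k : R).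

Lemma line_ofP u p : line_of u p <-> p.1 * u 0 0 + p.2 * u 0 1 + u 0 2 = 0.
Proof.
rewrite /line_of /= /incident; have -> : homog p = row3 p.1 p.2 1 by [].
split=> [/matrixP/(_ 0 0)|e]; first by rewrite dot3E !row3E mxE mul1r.
by apply/matrixP => i j; rewrite !ord1 dot3E !row3E mxE mul1r.
Qed.

Lemma affine_coords_neq0 u : affine_coords u -> u != 0.
Proof. by case=> u0; apply: contraNneq u0 => ->; rewrite mxE. Qed.

Lemma line_of_eq_scale u v :
  affine_coords u -> line_of u = line_of v -> exists c, v = c *: u.
Proof.
move=> au uv; pose s := u 0 0 ^+ 2 + u 0 1 ^+ 2.
have s0 : s != 0.
  rewrite paddr_eq0 ?sqr_ge0 // !sqrf_eq0 negb_and; exact/orP.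
pose foot := (- (u 0 0 * u 0 2) / s, - (u 0 1 * u 0 2) / s).
have /line_ofP/= v_foot : line_of v foot.
  by rewrite -uv; apply/line_ofP; rewrite /= /s; field.
have /line_ofP/= v_shift : line_of v (foot.1 - u 0 1, foot.2 + u 0 0).
  by rewrite -uv; apply/line_ofP; rewrite /= /s; field.
have parallel : u 0 0 * v 0 1 = u 0 1 * v 0 0 by lra.
exists ((u 0 0 * v 0 0 + u 0 1 * v 0 1) / s).
apply/rowP => i; rewrite mxE; apply: (mulIf s0); rewrite mulrAC divfK //.
case: (ord3E i) => ->; first by rewrite /s; ring: parallel.
  by rewrite /s; ring: parallel.
by apply/eqP; rewrite -subr_eq0 -(mulr0 s) -v_foot; apply/eqP; rewrite /foot /=; field.
Qed.

Lemma tangent_dual_form Q u : is_conic Q -> affine_coords u ->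
  tangent Q (line_of u) <-> dual_form Q u = 0.
Proof.
move=> [symQ rkQ] au; split=> [[v [P [av uv P0 Pv PQ]]]|uQ].
  have [c ->] := line_of_eq_scale av (esym uv).
  by rewrite dual_formZ (contact_dual_form_eq0 symQ rkQ P0 Pv PQ) mulr0.
have [P [P0 Pu PQ]] := dual_form_eq0_contact symQ rkQ (affine_coords_neq0 au) uQ.
by exists u, P.
Qed.

Lemma hyperbola_conic a b k : bracket a b != 0 -> is_conic (hyperbola a b k).
Proof. by move=> ab; split; [exact: tr_hyperbola | exact: rank_hyperbola]. Qed.

Lemma tangent_hyperbola a b l k : bracket a b != 0 -> affine_coords l ->
  2 * k * (bracket a l * bracket b l) = - det3 a b l ^+ 2 ->
  tangent (hyperbola a b k) (line_of l).
Proof.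
move=> ab affl kE; apply/tangent_dual_form => //; first exact: hyperbola_conic.
by rewrite dual_form_hyperbola kE addrN oppr0.
Qed.

Lemma tangent_asymptotes a b k : bracket a b != 0 -> affine_coords a -> affine_coords b ->
  tangent (hyperbola a b k) (line_of a) /\ tangent (hyperbola a b k) (line_of b).
Proof.
by move=> ab affa affb; split; apply: tangent_hyperbola => //; rewrite /det3 /bracket; ring.
Qed.

Lemma meet_bracket_neq0 u v p :
  affine_coords u -> (line_of u `&` line_of v)%classic = [set p]%classic -> bracket u v != 0.
Proof.
move=> au uv; apply/eqP => b0.
have [/line_ofP pu /line_ofP pv] : (line_of u `&` line_of v)%classic p by rewrite uv.
have : (line_of u `&` line_of v)%classic (p.1 - u 0 1, p.2 + u 0 0).
  split; apply/line_ofP => /=; first by rewrite -pu; ring.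
  by rewrite -pv -[RHS]addr0 -b0 /bracket; ring.
rewrite uv /=; case: p {uv pu pv} => x y /= [x_eq y_eq].
have [u0 u1] : u 0 0 = 0 /\ u 0 1 = 0 by split; lra.
by case: au; rewrite ?u0 ?u1 eqxx.
Qed.

Lemma meetE u v p : bracket u v != 0 -> line_of u p -> line_of v p ->
  p = ((u 0 1 * v 0 2 - u 0 2 * v 0 1) / bracket u v,
       (u 0 2 * v 0 0 - u 0 0 * v 0 2) / bracket u v).
Proof.
move=> uv /line_ofP pu /line_ofP pv; case: p pu pv => x y /= pu pv.
have u2 : u 0 2 = - (x * u 0 0 + y * u 0 1) by lra.
have v2 : v 0 2 = - (x * v 0 0 + y * v 0 1) by lra.
by congr pair; apply: (mulIf uv); rewrite divfK // /bracket u2 v2; ring.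
Qed.

Definition coord_area u v w : R :=
  det3 u v w ^+ 2 / (2 * `|bracket u v * bracket v w * bracket u w|).

Lemma triangle_area_coord u v w x : affine_coords u -> affine_coords v ->
  triangle_area (line_of u) (line_of v) (line_of w) x ->
  [/\ bracket u v != 0, bracket v w != 0, bracket u w != 0 & x = coord_area u v w].
Proof.
move=> au av [p [q [r [vw uw uv ->]]]].
have uv0 := meet_bracket_neq0 au uv; have vw0 := meet_bracket_neq0 av vw.
have uw0 := meet_bracket_neq0 au uw.
split=> //.
have [pv pw] : (line_of v `&` line_of w)%classic p by rewrite vw.
have [qu qw] : (line_of u `&` line_of w)%classic q by rewrite uw.
have [ru rv] : (line_of u `&` line_of v)%classic r by rewrite uv.
rewrite (meetE vw0 pv pw) (meetE uw0 qu qw) (meetE uv0 ru rv).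
rewrite /area /coord_area /=; set signed_area2 := (X in `|X|).
have -> : signed_area2 = - (det3 u v w ^+ 2 / (bracket u v * bracket v w * bracket u w)).
  rewrite /signed_area2 /det3; move: uv0 vw0 uw0; rewrite /bracket => uv0 vw0 uw0.
  by field; rewrite uv0 vw0 uw0.
rewrite normrN normrM normfV (ger0_norm (sqr_ge0 _)) invfM; ring.
Qed.

Lemma areaC12 p q r : area q p r = area p q r.
Proof. by rewrite /area -normrN; congr (`|_| / 2); ring. Qed.

Lemma areaC23 p q r : area p r q = area p q r.
Proof. by rewrite /area -normrN; congr (`|_| / 2); ring. Qed.

Lemma triangle_areaC12 (l1 l2 l3 : set (R * R)) x :
  triangle_area l1 l2 l3 x -> triangle_area l2 l1 l3 x.
Proof.
move=> [p [q [r [l23 l13 l12 ->]]]]; exists q, p, r.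
by rewrite (classical_sets.setIC l2 l1) areaC12.
Qed.

Lemma triangle_areaC23 (l1 l2 l3 : set (R * R)) x :
  triangle_area l1 l2 l3 x -> triangle_area l1 l3 l2 x.
Proof.
move=> [p [q [r [l23 l13 l12 ->]]]]; exists p, r, q.
by rewrite (classical_sets.setIC l3 l2) areaC23.
Qed.

(* The side of the pair on which the direction of the third line lies decides
   which of the two conjugate hyperbolas it touches. *)
Lemma tangent_hyperbola_coord_area a b l :
  bracket a b != 0 -> bracket b l != 0 -> bracket a l != 0 -> affine_coords l ->
  tangent (hyperbola a b ((-1) ^+ outside a b l * coord_area a b l * `|bracket a b|))
    (line_of l).
Proof.
move=> ab bl al affl; apply: tangent_hyperbola => //.
have norm_albl : `|bracket a l * bracket b l| =
    - (-1) ^+ outside a b l * (bracket a l * bracket b l).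
  rewrite /outside; case: ltgtP => [pos|neg|/esym/eqP].
  - by rewrite gtr0_norm // expr1 opprK mul1r.
  - by rewrite ltr0_norm // expr0 mulN1r.
  - by rewrite mulf_eq0 (negbTE al) (negbTE bl).
rewrite /coord_area -[bracket a b * _ * _]mulrA (mulrC (bracket b l)) normrM norm_albl.
have : `|bracket a b| != 0 by rewrite normr_eq0.
have : bracket a l * bracket b l != 0 by rewrite mulf_neq0.
move: (bracket a l * _) (`|_|) => al_bl norm_ab al_bl0 norm_ab0.
by case: (outside a b l); rewrite ?expr0 ?expr1; field; rewrite norm_ab0 al_bl0.
Qed.

Lemma is_line_lex_pos (l : set (R * R)) : is_line l ->
  exists u, [/\ lex_pos u, affine_coords u & l = line_of u].
Proof.
move=> [u au ->].
have [u_pos|u_npos] := boolP (lex_pos u); first by exists u.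
exists (- u); split.
- move: u_npos au; rewrite /lex_pos /affine_coords !mxE oppr_eq0 !oppr_gt0.
  by case: (ltgtP (u 0 0) 0) => //= _; case: (ltgtP (u 0 1) 0) => // _ _ [].
- by rewrite /affine_coords !mxE !oppr_eq0.
- by apply/seteqP; split=> p /line_ofP e; apply/line_ofP; move: e; rewrite !mxE; lra.
Qed.

End Lines.

Section Arrangements.
Variables (R : realType) (n : nat).
Implicit Types (L : 'I_n -> set (R * R)) (T : {set 'I_n}) (x : R).

Lemma card_tangent_le5 L Q :
  no_six_cotangent L -> is_conic Q -> (#|[set i | `[< tangent Q (L i) >]]| <= 5)%N.
Proof.
move=> no6 conicQ; rewrite leqNgt; apply/negP => /exists_subset_card[S /subsetP S_tan S6].
by apply: (no6 S S6); exists Q => // i /S_tan; rewrite inE => /asboolP.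
Qed.

Definition has_area L T x : Prop :=
  exists i j k, T = [set i; j; k] /\ triangle_area (L i) (L j) (L k) x.

Definition triangles L : {set {set 'I_n}} := [set T | `[< exists x, has_area L T x >]].

Definition triple_area L T : R := xget 0 (has_area L T).

Variable u : 'I_n -> 'rV[R]_3.
Let L i := line_of (u i).
Hypothesis u_affine : forall i, affine_coords (u i).

Lemma has_area_card T x : has_area L T x -> #|T| = 3%N.
Proof.
move=> [i [j [k [-> /(triangle_area_coord (u_affine i) (u_affine j))[ij jk ik _]]]]].
apply/eqP; rewrite cards3.
apply/and3P; split; [move: ij | move: ik | move: jk];
  by apply: contraNneq => ->; rewrite bracketxx.
Qed.

Lemma has_area_set3 i j k x :
  has_area L [set i; j; k] x -> triangle_area (L i) (L j) (L k) x.
Proof.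
move=> ijk_area; have ijk3 := has_area_card ijk_area.
case: ijk_area => a [b [c [eT abc_area]]].
pose P i j k := triangle_area (L i) (L j) (L k) x.
apply: (set3_sym_ind (P := P) _ _ ijk3 _ abc_area) => //.
- by move=> *; exact: triangle_areaC12.
- by move=> *; exact: triangle_areaC23.
Qed.

Lemma triple_areaE T x : has_area L T x -> triple_area L T = x.
Proof.
move=> Tx; have : has_area L T (triple_area L T) by exact: xgetI Tx.
case: Tx => i [j [k [-> /(triangle_area_coord (u_affine i) (u_affine j))[_ _ _ ->]]]].
by move=> /has_area_set3 /(triangle_area_coord (u_affine i) (u_affine j))[_ _ _ ->].
Qed.

Lemma triangles_card : {in triangles L, forall T, #|T| = 3%N}.
Proof. by move=> T; rewrite inE => /asboolP[x /has_area_card]. Qed.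

Lemma colour_class_coord_area i j k x :
  [set i; j; k] \in colour_class (triangles L) (triple_area L) x ->
  [/\ bracket (u i) (u j) != 0, bracket (u j) (u k) != 0, bracket (u i) (u k) != 0 &
      x = coord_area (u i) (u j) (u k)].
Proof.
rewrite !inE => /andP[/asboolP[y ijk_area] /eqP <-]; rewrite (triple_areaE ijk_area).
exact: (triangle_area_coord (u_affine i) (u_affine j) (has_area_set3 ijk_area)).
Qed.

Lemma distinct_areas_of_rainbow (S : {set 'I_n}) :
  rainbow (triangles L) (triple_area L) S -> distinct_areas L S.
Proof.
move=> S_rainbow i j k i' j' k' x x' iS jS kS iS' jS' kS' area_x area_x'.
apply: contraNneq => xx'.
have sub a b c : a \in S -> b \in S -> c \in S -> [set a; b; c] \subset S.
  by move=> aS bS cS; rewrite !subUset !sub1set aS bS.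
have T_area : has_area L [set i; j; k] x by exists i, j, k.
have T'_area : has_area L [set i'; j'; k'] x' by exists i', j', k'.
apply/eqP/S_rainbow; last by rewrite (triple_areaE T_area) (triple_areaE T'_area).
- by rewrite !inE sub // andbT; apply/asboolP; exists x.
- by rewrite !inE sub // andbT; apply/asboolP; exists x'.
Qed.

Lemma card_class_outside x a b (s : bool) : no_six_cotangent L -> a != b ->
  (#|[set l | ([set a; b; l] \in colour_class (triangles L) (triple_area L) x)
      && (outside (u a) (u b) (u l) == s)]| <= 3)%N.
Proof.
move=> no6 ab; set F := [set l | _].
have [->|[l0]] := set_0Vmem F; first by rewrite cards0.
rewrite inE => /andP[/colour_class_coord_area[ab0 _ _ _] _].
pose Q := hyperbola (u a) (u b) ((-1) ^+ s * x * `|bracket (u a) (u b)|).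
have conicQ : is_conic Q by exact: hyperbola_conic.
have [tan_a tan_b] : tangent Q (L a) /\ tangent Q (L b) by exact: tangent_asymptotes.
have F_tan l : l \in F -> [/\ l != a, l != b & tangent Q (L l)].
  rewrite inE => /andP[/colour_class_coord_area[_ bl al x_area] /eqP s_out]; split.
  - by apply: contraNneq al => ->; rewrite bracketxx.
  - by apply: contraNneq bl => ->; rewrite bracketxx.
  - by rewrite /Q x_area -s_out; exact: tangent_hyperbola_coord_area.
have aF : a \notin F by apply/negP => /F_tan[]; rewrite eqxx.
have bF : b \notin F by apply/negP => /F_tan[_]; rewrite eqxx.
rewrite -(leq_add2l 2); apply: leq_trans (card_tangent_le5 no6 conicQ).
have -> : (2 + #|F| = #|a |: (b |: F)|)%N by rewrite !cardsU1 in_setU1 negb_or ab aF bF.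
apply/subset_leq_card/subsetP => l l_abF; rewrite inE; apply/asboolP; move: l_abF.
by rewrite !in_setU1 => /or3P[/eqP->|/eqP->|/F_tan[]].
Qed.

Hypothesis u_pos : forall i, lex_pos (u i).

Lemma triangle_two_outside : {in triangles L, forall T, exists a b l,
  [/\ T = [set a; b; l], outside (u a) (u b) (u l) & outside (u b) (u l) (u a)]}.
Proof.
move=> T; rewrite inE => /asboolP[x [i [j [k [-> ]]]]].
move=> /(triangle_area_coord (u_affine i) (u_affine j))[ij jk ik _].
have := outside_two_of_three (u_pos i) (u_pos j) (u_pos k) ij jk ik.
case/or3P=> /andP[out1 out2].
- by exists i, j, k.
- by exists j, k, i; split=> //; rewrite -setUA setUC.
- by exists k, i, j; split=> //; rewrite setUC setUA.
Qed.

End Arrangements.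

Lemma guaranteed_fifth_root (R : realType) (n N : nat) :
  (N < n)%N -> (N ^ 5 <= n)%N -> guaranteed R n N.+1.
Proof.
move=> Nn N5n L [_ L_lines] no6.
have /choice[u uP] : forall i, exists u : 'rV[R]_3,
  [/\ lex_pos u, affine_coords u & L i = line_of u] by move=> i; exact: is_line_lex_pos.
have u_pos i : lex_pos (u i) by case: (uP i).
have u_affine i : affine_coords (u i) by case: (uP i).
have eL : (fun i => line_of (u i)) = L by apply/funext => i; case: (uP i).
rewrite -eL in no6 *.
have [||S cS S_rainbow] := exists_rainbow_set (N := N) (triangles_card u_affine)
    (fun a b l => outsideC (u a) (u b) (u l)) (triangle_two_outside u_affine u_pos)
    (fun x a b s => card_class_outside u_affine x s no6); rewrite ?card_ord //.
by exists S; split=> //; exact: distinct_areas_of_rainbow.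
Qed.

Lemma sum_roots_eq0 (F : fieldType) (p : {poly F}) (rs : seq F) :
  p != 0 -> uniq rs -> all (root p) rs -> rs != [::] ->
  (size p <= (size rs).+1)%N -> p`_(size rs).-1 = 0 -> \sum_(r <- rs) r = 0.
Proof.
move=> p0 rs_uniq rs_root; rewrite -size_eq0 => rs0 size_le p_coef0.
have size_p : size p = (size rs).+1 by apply/eqP; rewrite eqn_leq size_le max_poly_roots.
have rs_uniq_roots : uniq_roots rs by rewrite uniq_rootsE.
have := all_roots_prod_XsubC size_p rs_root rs_uniq_roots.
move/(congr1 (fun q : {poly F} => q`_(size rs).-1)).
rewrite p_coef0 coefZ coefPn_prod_XsubC // => /esym/eqP.
by rewrite mulf_eq0 lead_coef_eq0 (negbTE p0) oppr_eq0 => /eqP.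
Qed.

Section CubicForm.
Variable R : realFieldType.

Definition cubic_line (t : R) : 'rV[R]_3 := row3 1 t (t ^+ 3).

Definition cubic_form (A : 'M[R]_3) : {poly R} :=
  Poly [:: A 0 0; 2 * A 0 1; A 1 1; 2 * A 0 2; 2 * A 1 2; 0; A 2 2].

Lemma horner_cubic_form (A : 'M[R]_3) (t : R) :
  A^T = A -> (cubic_form A).[t] = (cubic_line t *m A *m (cubic_line t)^T) 0 0.
Proof.
move=> symA; have sym i j : A j i = A i j by rewrite -{1}symA mxE.
by rewrite horner_Poly mxE sum3E !mxE !sum3E !mxE /= (sym 0 1) (sym 0 2) (sym 1 2); ring.
Qed.

Lemma cubic_form_eq0 (A : 'M[R]_3) : A^T = A -> cubic_form A = 0 -> A = 0.
Proof.
move=> symA A0; have sym i j : A j i = A i j by rewrite -{1}symA mxE.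
have coef k : (cubic_form A)`_k = 0 by rewrite A0 coef0.
have := (coef 0, coef 1, coef 2, coef 3, coef 4, coef 6)%N.
rewrite !coef_Poly /= => -[[[[[A00 A01] A11] A02] A12] A22].
have {}A01 : A 0 1 = 0 by lra.
have {}A02 : A 0 2 = 0 by lra.
have {}A12 : A 1 2 = 0 by lra.
apply/matrixP => i j; rewrite mxE.
by case: (ord3E i) => ->; case: (ord3E j) => ->; rewrite // sym.
Qed.

Lemma sym_eq0_of_cubic_roots (A : 'M[R]_3) (ts : seq R) :
  A^T = A -> uniq ts -> size ts = 6%N -> {in ts, forall t, 0 < t} ->
  {in ts, forall t, (cubic_line t *m A *m (cubic_line t)^T) 0 0 = 0} -> A = 0.
Proof.
move=> symA ts_uniq ts6 ts_gt0 ts_root; apply: cubic_form_eq0 => //.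
apply/eqP/negPn/negP => form_neq0.
have : \sum_(t <- ts) t = 0.
  apply: (sum_roots_eq0 form_neq0) => //; rewrite -?size_eq0 ?ts6 ?coef_Poly ?size_Poly //.
  by apply/allP => t /ts_root; rewrite -horner_cubic_form // => /rootP.
apply/eqP/lt0r_neq0.
case: ts ts6 ts_gt0 {ts_uniq ts_root} => // t ts _ ts_gt0; rewrite big_cons big_seq.
rewrite ltr_pwDl ?ts_gt0 ?mem_head // sumr_ge0 // => s s_ts.
by rewrite ltW // ts_gt0 // inE s_ts orbT.
Qed.

End CubicForm.

Section CubicArrangement.
Variable R : realType.

Lemma cubic_line_affine (t : R) : affine_coords (cubic_line t).
Proof. by left; rewrite row3E oner_neq0. Qed.

Definition cubic_arrangement (n : nat) (i : 'I_n) : set (R * R) :=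
  line_of (cubic_line i.+1%:R).

Lemma cubic_line_arrangement n : line_arrangement (@cubic_arrangement n).
Proof.
split=> [i j /(line_of_eq_scale (cubic_line_affine _))[c /rowP cE]|i]; last first.
  by exists (cubic_line i.+1%:R) => //; exact: cubic_line_affine.
have := cE 0; have := cE 1; rewrite !mxE /= mulr1 => + c1; rewrite -c1 mul1r => /eqP.
by rewrite eqr_nat eqSS => /eqP/esym/val_inj.
Qed.

Lemma cubic_no_six_cotangent n : no_six_cotangent (@cubic_arrangement n).
Proof.
move=> S S6 [Q conicQ S_tan]; have [symQ rkQ] := conicQ.
have /eqP : \adj Q != 0 by rewrite adj_neq0.
apply; apply: (sym_eq0_of_cubic_roots (ts := [seq i.+1%:R | i : 'I_n <- enum S])).
- by rewrite trmx_adj symQ.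
- by rewrite map_inj_uniq ?enum_uniq // => i j /eqP; rewrite eqr_nat eqSS => /eqP/val_inj.
- by rewrite size_map -cardE.
- by move=> t /mapP[i _ ->]; rewrite ltr0n.
move=> t /mapP[i]; rewrite mem_enum => /S_tan tan_i ->.
exact/(tangent_dual_form conicQ (cubic_line_affine _)).
Qed.

End CubicArrangement.

Lemma guaranteed_le (R : realType) (n d : nat) : guaranteed R n d -> (d <= n)%N.
Proof.
move=> /(_ _ (@cubic_line_arrangement R n) (@cubic_no_six_cotangent R n))[S [<- _]].
by rewrite -[leqRHS]card_ord max_card.
Qed.

Lemma guaranteed_le_D (R : realType) (n d : nat) : guaranteed R n d -> (d <= D R n)%N.
Proof.
move=> d_guar.
have some_guar : exists d, `[< guaranteed R n d >] by exists d; apply/asboolP.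
have guar_bounded d' : `[< guaranteed R n d' >] -> (d' <= n)%N.
  by move=> /asboolP/guaranteed_le.
have [m /asboolP m_guar m_max] := ex_maxnP some_guar guar_bounded.
suff [_] : is_largest (guaranteed R n) (D R n) by apply.
by apply: xgetPex; exists m; split=> // d' d'_guar; apply/m_max/asboolP.
Qed.

Lemma exists_floor_root (k n : nat) :
  (0 < k)%N -> exists N, (N ^ k <= n < N.+1 ^ k)%N.
Proof.
move=> k0; have some_root : exists N, (N ^ k <= n)%N by exists 0%N; rewrite exp0n.
have root_bounded N : (N ^ k <= n)%N -> (N <= n)%N.
  by apply: leq_trans; case: N => // N; rewrite -[leqLHS]expn1 leq_pexp2l.
have [N N_le N_max] := ex_maxnP some_root root_bounded.
by exists N; rewrite N_le ltnNge; apply/negP => /N_max; rewrite ltnn.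
Qed.

Lemma powR_invn_lt (R : realType) (x y : R) (k : nat) :
  (0 < k)%N -> 0 <= x -> 0 <= y -> x < y ^+ k -> x `^ (k%:R^-1) < y.
Proof.
move=> k0 x0 y0 xy; have k_neq0 : (k%:R : R) != 0 by rewrite pnatr_eq0 -lt0n.
have -> : y = (y ^+ k) `^ k%:R^-1 by rewrite -powR_mulrn // -powRrM divff // powRr1.
by apply: gt0_ltr_powR; rewrite ?invr_gt0 ?ltr0n ?nnegrE ?exprn_ge0.
Qed.

Theorem theorem4 (R : realType) (n : nat) (hn : (2 <= n)%N) :
  (n%:R : R) `^ (5%:R^-1) < (D R n)%:R.
Proof.
have [N /andP[N5n nN5]] := exists_floor_root n (isT : (0 < 5)%N).
have Nn : (N < n)%N.
  have [N1|N2] := leqP N 1; first exact: leq_trans hn.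
  by apply: leq_trans N5n; rewrite -[ltnLHS]expn1 ltn_exp2l.
have le_D := guaranteed_le_D (guaranteed_fifth_root Nn N5n).
apply: (@lt_le_trans _ _ N.+1%:R); last by rewrite ler_nat.
by apply: powR_invn_lt; rewrite ?ler0n // -natrX ltr_nat.
Qed.
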